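(* Let $G$ be a graph with vertex set $\{1,\dots,n\}$ and let $A$ be a real $n\times n$ combinatorially symmetric matrix whose graph is $G$. Then $\operatorname{nul}(A) = \tau(\mathcal{F}_A^{\min}) = \tau(\mathcal{F}_A)$.
   Context: Graphs are finite and simple. A real $n\times n$ matrix $A=[a_{ij}]$ is combinatorially symmetric if $a_{ij}\neq 0$ if and only if $a_{ji}\neq 0$. The graph of such an $A$ has vertex set $\{1,\dots,n\}$ and edges $\{ij : i\neq j,\ a_{ij}\neq 0\}$ (the diagonal entries of $A$ are unrestricted). $\operatorname{Nul}(A)$ is the null space of $A$ and $\operatorname{nul}(A)$ its dimension. The support of a vector $x=(x_i)\in\mathbb{R}^n$ is $\operatorname{supp}(x)=\{i : x_i\neq 0\}$. Define $\mathcal{F}_A = \{\operatorname{supp}(x) : x\in\operatorname{Nul}(A),\ x\neq 0\}$, and let $\mathcal{F}_A^{\min}$ be the collection of those sets in $\mathcal{F}_A$ that do not properly contain any other set in $\mathcal{F}_A$. For a collection $\mathcal{S}$ of subsets of $\{1,\dots,n\}$, the transversal number is $\tau(\mathcal{S}) = \min\{|T| : T\subseteq\{1,\dots,n\},\ T\cap S\neq\emptyset \text{ for all } S\in\mathcal{S}\}$. *)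

(* Defs.v *)
From mathcomp Require Import all_boot all_order all_algebra.
From mathcomp Require Import boolp reals.

Set Implicit Arguments.
Unset Strict Implicit.
Unset Printing Implicit Defensive.

Import GRing.Theory.
Local Open Scope ring_scope.

Definition simple_graph (V : finType) (G : rel V) : Prop :=
  symmetric G /\ irreflexive G.

Definition comb_symmetric (R : realType) (n : nat) (A : 'M[R]_n) : Prop :=
  forall i j : 'I_n, (A i j != 0) <-> (A j i != 0).

Definition graph_of (R : realType) (n : nat) (A : 'M[R]_n) : rel 'I_n :=
  fun i j => (i != j) && (A i j != 0).

(* The right null space {x | A x = 0}; [kermx A] would be the left one. *)
Definition Nul (R : realType) (n : nat) (A : 'M[R]_n) : {vspace 'cV[R]_n} :=
  lker (linfun (mulmx A : 'cV[R]_n -> 'cV[R]_n)).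

Definition nul (R : realType) (n : nat) (A : 'M[R]_n) : nat := \dim (Nul A).

Definition supp (R : realType) (n : nat) (x : 'cV[R]_n) : {set 'I_n} :=
  [set i | x i 0 != 0].

Definition null_supports (R : realType) (n : nat) (A : 'M[R]_n) :
    {set {set 'I_n}} :=
  [set S | `[< exists x : 'cV[R]_n, [/\ x \in Nul A, x != 0 & S = supp x] >]].

Definition minimal_sets (V : finType) (F : {set {set V}}) : {set {set V}} :=
  [set S in F | [forall S' in F, ~~ (S' \proper S)]].

Definition hitting_set (V : finType) (F : {set {set V}}) (T : {set V}) : bool :=
  [forall S in F, T :&: S != set0].

(* The starting value [set: V] is itself a hitting set as soon as
   [set0 \notin F]; if [set0 \in F] there is no hitting set and the value is
   meaningless. Supports of nonzero vectors are nonempty. *)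
Definition transversal_number (V : finType) (F : {set {set V}}) : nat :=
  #|[arg min_(T < [set: V] | hitting_set F T) #|T|]|.

(* Main.v *)
Require Import Defs.
From mathcomp Require Import all_boot all_order all_algebra.
From mathcomp Require Import boolp reals.

(** A set [T] of coordinates meets the support of every nonzero null vector of
    [A] exactly when no nonzero null vector vanishes on [T], that is, when
    restriction to the coordinates in [T] is injective on the null space
    ([hitting_null_supportsP]). So the transversal number is the least size of
    a set of coordinates that determines the vectors of a subspace [U], and
    linear algebra says that this size is [\dim U]: an injective map into the
    space of functions on [T] needs [#|T|] to be at least [\dim U]
    ([dim_leq_determining]), and as long as [U] is nonzero, imposing the
    vanishing of one coordinate that is not identically zero on [U] lowers the
    dimension, so [\dim U] coordinates suffice ([exists_determining]).

    Passing to the minimal supports changes nothing, because in a finite family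
    every set contains a minimal one, which has to be hit as well
    ([hitting_minimal_sets]). *)

Set Implicit Arguments.
Unset Strict Implicit.
Unset Printing Implicit Defensive.

Import GRing.Theory.
Local Open Scope ring_scope.

Section Transversals.

Variable V : finType.
Implicit Types (F : {set {set V}}) (S T : {set V}).

Lemma hitting_setP F T :
  reflect (forall S, S \in F -> T :&: S != set0) (hitting_set F T).
Proof. exact: 'forall_in_idP. Qed.

Lemma exists_minimal_subset F S :
  S \in F -> exists2 S', S' \in minimal_sets F & S' \subset S.
Proof.
move=> FS; have [S' minS' sS'S] := minset_exists (P := mem F) FS.
have [FS' minimalS'] := minsetP minS'.
exists S' => //; rewrite inE [S' \in F]FS'; apply/'forall_in_idP => S'' FS''.
rewrite properEneq; apply/andP => -[/eqP neq sub].
by apply: neq; apply: minimalS'.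
Qed.

(** Every member of the finite family [F] contains a minimal one, and a set
    that meets a subset of [S] meets [S]. *)
Lemma hitting_minimal_sets F : hitting_set (minimal_sets F) =1 hitting_set F.
Proof.
move=> T; apply/hitting_setP/hitting_setP => hitT S FS; last first.
  by apply: hitT; move: FS; rewrite inE => /andP[].
have [S' minS' sS'S] := exists_minimal_subset FS.
apply: contraNneq (hitT _ minS') => TS0.
by rewrite -subset0 -TS0 setIS.
Qed.

(** The hypothesis that some hitting set exists is what makes the minimum
    meaningful: it forces the members of [F] to be nonempty, so the default
    value [setT] is admissible. *)
Lemma transversal_number_eq F d T0 :
    hitting_set F T0 -> (#|T0| <= d)%N ->
    (forall T, hitting_set F T -> (d <= #|T|)%N) ->
  transversal_number F = d.
Proof.
move=> hitT0 leT0d led; rewrite /transversal_number.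
have hitV : hitting_set F [set: V].
  apply/hitting_setP => S FS; apply: contraNneq (hitting_setP _ _ hitT0 S FS).
  by rewrite setTI => ->; rewrite setI0.
case: arg_minnP => // T hitT minT.
by apply/eqP; rewrite eqn_leq led // (leq_trans (minT _ hitT0)).
Qed.

End Transversals.

Section DeterminingCoordinates.

Variables (K : fieldType) (n : nat).
Implicit Types (U : {vspace 'cV[K]_n}) (T : {set 'I_n}) (x : 'cV[K]_n).

Definition restriction T : 'Hom('cV[K]_n, 'cV[K]_#|T|) :=
  linfun (rowsub (@enum_val _ (mem T))).

Lemma restriction_kerP T x :
  reflect {in T, forall i, x i 0 = 0} (x \in lker (restriction T)).
Proof.
rewrite memv_ker lfunE /=.
apply: (iffP eqP) => [/colP xT0 i Ti | xT0].
  by have := xT0 (enum_rank_in Ti i); rewrite !mxE enum_rankK_in.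
by apply/colP => j; rewrite !mxE xT0 ?enum_valP.
Qed.

(** Restriction to [T] embeds [U] into a space of dimension [#|T|]. *)
Lemma dim_leq_determining U T :
  (U :&: lker (restriction T) = 0)%VS -> (\dim U <= #|T|)%N.
Proof.
move=> UT0; rewrite -(limg_dim_eq UT0).
by apply: leq_trans (dimvS (subvf _)) _; rewrite dimvf /dim /= muln1.
Qed.

(** Coordinates are chosen greedily: each one must be nonzero somewhere on the
    part of [U] where the earlier ones vanish, so the dimension of that part
    drops at every choice and is zero after at most [\dim U] of them. *)
Lemma exists_determining U :
  exists2 T, (U :&: lker (restriction T) = 0)%VS & (#|T| <= \dim U)%N.
Proof.
have [d] := ubnP (\dim U); elim: d U => // d IHd U; rewrite ltnS => leUd.
have [-> | U_neq0] := eqVneq U 0%VS.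
  by exists set0; rewrite ?cap0v ?cards0.
(* A coordinate [i] that is nonzero at some vector of [U] cuts out a proper
   subspace [W], to which the induction hypothesis applies. *)
have Ux := memv_pick U; have /cV0Pn[i xi_neq0] : vpick U != 0 by rewrite vpick0.
pose W := (U :&: lker (restriction [set i]))%VS.
have ltWU : (\dim W < \dim U)%N.
  rewrite ltn_neqAle dimvS ?capvSl // andbT.
  apply: contraNneq xi_neq0 => /eqP; rewrite eq_sym => eqWU.
  have eqW : W = U by apply/eqP; rewrite eqEdim capvSl -(eqP eqWU) leqnn.
  move: Ux; rewrite -{2}eqW memv_cap => /andP[_ /restriction_kerP].
  by move=> -> //; rewrite set11.
have [T WT0 leTW] := IHd W (leq_trans ltWU leUd).
exists (i |: T); last first.
  by apply: leq_trans ltWU; rewrite cardsU1 -add1n leq_add ?leq_b1.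
apply/eqP; rewrite -subv0 -WT0; apply/subvP => y.
rewrite !memv_cap => /andP[-> /restriction_kerP yiT0] /=.
by apply/andP; split; apply/restriction_kerP => j jT; apply: yiT0;
  move: jT; rewrite !inE => ->; rewrite ?orbT.
Qed.

End DeterminingCoordinates.

(** A nonzero null vector whose support misses [T] is the same thing as a
    nonzero element of the kernel of restriction to [T] on the null space. *)
Lemma hitting_null_supportsP (R : realType) (n : nat) (A : 'M[R]_n)
    (T : {set 'I_n}) :
  reflect (Nul A :&: lker (restriction R T) = 0)%VS
          (hitting_set (null_supports A) T).
Proof.
apply: (iffP (hitting_setP _ _)) => [hitT | NT0 S].
  apply/eqP; rewrite -subv0; apply/subvP => x.
  rewrite memv_cap memv0 => /andP[Nx /restriction_kerP xT0].
  apply/negPn/negP => x_neq0.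
  have /set0Pn[i] : T :&: supp x != set0.
    by apply: hitT; rewrite inE; apply/asboolP; exists x.
  by rewrite !inE => /andP[/xT0 ->]; rewrite eqxx.
rewrite inE => /asboolP[x [Nx x_neq0 ->]].
apply: contraNneq x_neq0 => TS0; rewrite -memv0 -NT0 memv_cap Nx.
apply/restriction_kerP => i Ti; apply/eqP/negPn/negP => xi_neq0.
suff : i \in T :&: supp x by rewrite TS0 inE.
by rewrite !inE Ti.
Qed.

Theorem lemma3p2 (R : realType) (n : nat) (G : rel 'I_n) (A : 'M[R]_n)
    (hG : simple_graph G) (hA : comb_symmetric A) (hGA : graph_of A =2 G) :
  nul A = transversal_number (minimal_sets (null_supports A)) /\
  transversal_number (minimal_sets (null_supports A)) =
    transversal_number (null_supports A).
Proof.
have [T /hitting_null_supportsP hitT leT] := exists_determining (Nul A).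
have geN T' : hitting_set (null_supports A) T' -> (nul A <= #|T'|)%N.
  by move/hitting_null_supportsP/dim_leq_determining.
have -> : transversal_number (null_supports A) = nul A.
  exact: transversal_number_eq hitT leT geN.
suff -> : transversal_number (minimal_sets (null_supports A)) = nul A by [].
apply: (transversal_number_eq (T0 := T)) => // [|T'];
  by rewrite hitting_minimal_sets //; apply: geN.
Qed.
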